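(* Let $n,s\ge 1$ be integers, let $a>0$ be a real number, and let $M_1,\ldots,M_s$ be a family of subsets of the set $[n]$. If $2^{a^2}\ge (2s)^{2n}$, then there exists a coloring of the set $[n]$ in red and blue such that for every $k\in[s]$ the numbers of red and of blue elements in $M_k$ differ by less than $a$ (i.e. the absolute value of their difference is less than $a$).
   Context: For a positive integer $m$, $[m]:=\{1,\ldots,m\}$. A coloring of $[n]$ in red and blue assigns to each element of $[n]$ exactly one of the two colors. *)

(* Defs.v *)
From mathcomp Require Import all_boot all_order all_algebra.

Set Implicit Arguments.
Unset Strict Implicit.
Unset Printing Implicit Defensive.

(* The ground set [n] = {1, ..., n} is represented by 'I_n = {0, ..., n-1};
   a coloring is encoded by booleans: true is red, false is blue. *)
Definition coloring (n : nat) : Type := {ffun 'I_n -> bool}.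

Definition red_in (n : nat) (c : coloring n) (A : {set 'I_n}) : {set 'I_n} :=
  [set x in A | c x].

Definition blue_in (n : nat) (c : coloring n) (A : {set 'I_n}) : {set 'I_n} :=
  [set x in A | ~~ c x].

(* Main.v *)
Require Import Defs.
From mathcomp Require Import all_boot all_order all_algebra.
From mathcomp Require Import reals exp.
From mathcomp Require Import topology normedtype sequences.
From mathcomp Require Import ring lra.

(** Color [n] uniformly at random and let X_k be the number of red minus the
    number of blue elements of M_k, a sum of at most n independent signs.
    Since cosh t <= exp (t^2 / 2) ([expR_add_expRN_le]), the mean of exp (t X_k)
    is at most exp (n t^2 / 2) ([sum_expR_discrepancy_le]).  A coloring with
    |X_k| >= a for some k has
      exp (t a) < sum over k of (exp (t X_k) + exp (- t X_k)),
    so if every coloring were of this kind, averaging would give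
      exp (t a) < 2 s exp (n t^2 / 2).
    At the optimal t = a / n this reads exp (a^2 / (2 n)) < 2 s, hence
    exp (a^2) < (2 s)^(2 n) <= 2^(a^2), which is absurd because 2 < e. *)

Set Implicit Arguments.
Unset Strict Implicit.
Unset Printing Implicit Defensive.

Import Order.TTheory GRing.Theory Num.Theory.
Import numFieldNormedType.Exports.

Local Open Scope ring_scope.

Definition discrepancy (R : pzRingType) (n : nat) (c : coloring n)
    (A : {set 'I_n}) : R := #|red_in c A|%:R - #|blue_in c A|%:R.

Lemma discrepancyE (R : pzRingType) (n : nat) (c : coloring n)
    (A : {set 'I_n}) :
  discrepancy R c A = \sum_(i in A) (-1) ^+ (~~ c i).
Proof.
rewrite (bigID (fun i => c i)) /= /discrepancy -!sum1_card !natr_sum -sumrN.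
congr (_ + _); apply: eq_big => i; rewrite ?inE //.
- by case/andP=> _ ->.
- by case/andP=> _ ->.
Qed.

Lemma leq_exp2_fact (k : nat) : (2 ^ k * k`! <= k.*2`!)%N.
Proof.
elim: k => // k IH; rewrite doubleS !factS expnS.
rewrite [leqLHS](_ : _ = k.+1.*2 * (2 ^ k * k`!))%N; last first.
  by rewrite -muln2; ring.
by rewrite doubleS leq_mul // (leq_trans IH) // leq_pmull.
Qed.

(** Both sides are twice a power series in t^2: that of cosh has coefficients
    1 / (2k)!, that of exp (t^2 / 2) has coefficients 1 / (2^k k!), and
    [leq_exp2_fact] compares them.  The comparison is made on partial sums. *)
Lemma expR_add_expRN_le (R : realType) (t : R) :
  expR t + expR (- t) <= 2 * expR (t ^+ 2 / 2).
Proof.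
have nonneg_terms i : 0 <= exp_coeff t i + exp_coeff (- t) i.
  rewrite /exp_coeff /= exprNn -signr_odd -mulrDl divr_ge0 //.
  case: (boolP (odd i)) => [_|even_i]; first by rewrite expr1 mulN1r subrr.
  by rewrite expr0 mul1r addr_ge0 // exprn_even_ge0.
have even_terms m :
    \sum_(0 <= i < m.*2) (exp_coeff t i + exp_coeff (- t) i)
    <= 2 * \sum_(0 <= k < m) exp_coeff (t ^+ 2 / 2) k.
  elim: m => [|m IH]; first by rewrite !big_geq // mulr0.
  rewrite doubleS !big_nat_recr //= mulrDr -addrA lerD //.
  rewrite /exp_coeff /= [(- t) ^+ _.+1]exprNn [(- t) ^+ _.*2]exprNn.
  rewrite -[(-1) ^+ m.*2.+1]signr_odd -[(-1) ^+ m.*2]signr_odd /= odd_double /=.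
  rewrite !(expr0, expr1, mul1r, mulN1r) mulNr subrr addr0 -mulr2n -[leLHS]mulr_natl.
  rewrite ler_pM2l // expr_div_n -exprM mul2n -mulrA.
  apply: ler_wpM2l; first by rewrite -mul2n exprM exprn_ge0 // sqr_ge0.
  rewrite -invfM lef_pV2 ?posrE ?mulr_gt0 ?exprn_gt0 ?ltr0n ?fact_gt0 //.
  by rewrite -natrX -natrM ler_nat leq_exp2_fact.
have sq_ge0 : 0 <= t ^+ 2 / 2 by rewrite divr_ge0 ?sqr_ge0.
have partial_sums N :
    series (exp_coeff t) N + series (exp_coeff (- t)) N
    <= 2 * expR (t ^+ 2 / 2).
  rewrite /series /= -big_split /=.
  (* Lengthening the sum to an even number of terms only increases it. *)
  apply: (@le_trans _ _
    (\sum_(0 <= i < N.*2) (exp_coeff t i + exp_coeff (- t) i))).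
    rewrite (@big_cat_nat _ _ _ N 0 N.*2) //= -?addnn ?leq_addl //.
    by rewrite lerDl sumr_ge0.
  apply: (le_trans (even_terms N)); rewrite ler_pM2l //.
  apply: nondecreasing_cvgn_le; last exact: is_cvg_series_exp_coeff.
  by apply: nondecreasing_series => i _ _; exact: exp_coeff_ge0.
have cvg_expR := @is_cvg_series_exp_coeff R.
rewrite -[leLHS](limD (cvg_expR t) (cvg_expR (- t))).
apply: limr_le; last exact: nearW.
by apply: is_cvgD; exact: cvg_expR.
Qed.

(** The exponential turns the sum of signs over A into a product with one
    factor per element, so the sum over all colorings factorizes: an element of
    A contributes 2 cosh t, any other element contributes 2. *)
Lemma sum_expR_discrepancy_le (R : realType) (n : nat) (A : {set 'I_n})
    (t : R) :
  \sum_(c : coloring n) expR (t * discrepancy R c A)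
    <= (2 * expR (t ^+ 2 / 2)) ^+ n.
Proof.
pose w (i : 'I_n) (b : bool) : R :=
  if i \in A then expR (t * (-1) ^+ (~~ b)) else 1.
have -> : \sum_(c : coloring n) expR (t * discrepancy R c A)
    = \prod_i \sum_b w i b.
  rewrite bigA_distr_bigA; apply: eq_bigr => c _.
  by rewrite discrepancyE mulr_sumr expR_sum big_mkcond.
rewrite -[X in _ ^+ X]card_ord -prodr_const; apply: ler_prod => i _.
rewrite /w big_bool; case: (i \in A) => /=.
  by rewrite expr0 expr1 mulr1 mulrN1 addr_ge0 ?expR_ge0 //= expR_add_expRN_le.
have := expR_ge1Dx (t ^+ 2 / 2); have := sqr_ge0 t; lra.
Qed.

Theorem mainTheorem2 (R : realType) (n s : nat) (a : R)
    (M : 'I_s -> {set 'I_n}) (hn : (1 <= n)%N) (hs : (1 <= s)%N)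
    (ha : 0 < a)
    (h : 2 `^ (a ^+ 2) >= (2 * s%:R) ^+ (2 * n)) :
  exists c : coloring n, forall k : 'I_s,
    `| #|red_in c (M k)|%:R - #|blue_in c (M k)|%:R | < a.
Proof.
have [/existsP[c /forallP hc]|] := boolP
  [exists c : {ffun 'I_n -> bool},
     [forall k, `|discrepancy R (c : coloring n) (M k)| < a]].
  by exists c.
rewrite negb_exists => /forallP allbad; exfalso.
have n0 : n%:R != 0 :> R by rewrite pnatr_eq0 -lt0n.
have npos : 0 < n%:R :> R by rewrite ltr0n.
pose t := a / n%:R.
have tpos : 0 < t by rewrite divr_gt0.
have bad_weight (c : coloring n) : expR (t * a) <
    \sum_k (expR (t * discrepancy R c (M k))
            + expR (- t * discrepancy R c (M k))).
  have := allbad c; rewrite negb_forall => /existsP[k]; rewrite -leNgt => hk.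
  rewrite (bigD1 k) //= -[ltLHS]addr0 ltr_leD //; last first.
    by apply: sumr_ge0 => j _; rewrite addr_ge0 ?expR_ge0.
  move: hk; case: ger0P => _ hk.
    by rewrite ltr_pwDr ?expR_gt0 // ler_expR ler_pM2l.
  by rewrite ltr_pwDl ?expR_gt0 // ler_expR mulNr -mulrN ler_pM2l.
have total : 2 ^+ n * expR (t * a) < 2 ^+ n * (2 * s%:R * expR (t * a / 2)).
  have -> : 2 ^+ n * expR (t * a) = \sum_(c : coloring n) expR (t * a).
    by rewrite sumr_const card_ffun card_bool card_ord -[RHS]mulr_natl natrX.
  apply: (@lt_le_trans _ _ (\sum_(c : coloring n) \sum_k
    (expR (t * discrepancy R c (M k)) + expR (- t * discrepancy R c (M k))))).
    apply: ltr_sum => //.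
    by apply/hasP; exists [ffun=> true]; rewrite // mem_index_enum.
  (* Each of the 2 s exponential moments is bounded separately. *)
  rewrite exchange_big /=.
  have -> : 2 ^+ n * (2 * s%:R * expR (t * a / 2))
      = \sum_(k < s) 2 * (2 * expR (t ^+ 2 / 2)) ^+ n.
    rewrite sumr_const card_ord -[RHS]mulr_natl exprMn -expRM_natl.
    have -> : n%:R * (t ^+ 2 / 2) = t * a / 2 by rewrite /t; field.
    by ring.
  apply: ler_sum => k _; rewrite big_split /= mulr_natl mulr2n lerD //.
    exact: sum_expR_discrepancy_le.
  by rewrite -[t ^+ 2]sqrrN sum_expR_discrepancy_le.
have s_large : expR (t * a / 2) < 2 * s%:R.
  move: total; rewrite ltr_pM2l ?exprn_gt0 //.
  rewrite {1}[t * a]splitr.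
  by rewrite expRD ltr_pM2r ?expR_gt0.
have n2_neq0 : (2 * n)%N != 0%N by rewrite muln_eq0 /= -lt0n.
have : expR (t * a / 2) ^+ (2 * n) < 2 `^ (a ^+ 2).
  by apply: lt_le_trans h; rewrite ltrXn2r ?expR_ge0.
rewrite -expRM_natl natrM /powR pnatr_eq0 /= ltr_expR.
have -> : 2 * n%:R * (t * a / 2) = a ^+ 2 by rewrite /t; field.
(* The exponents now contradict ln 2 <= 1. *)
apply/negP; rewrite -leNgt -[leRHS]mulr1 ler_wpM2l ?sqr_ge0 //.
have -> : (2 : R) = 1 + 1 by [].
by apply: le_ln1Dx; lra.
Qed.
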